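(* Let $h:\mathbb{R}^2\to\mathbb{R}^2$ be a bi-Lipschitz homeomorphism, and let $\phi:[0,\infty)\to(0,1]$ be a continuous function monotonically decreasing to zero which decays sub-exponentially fast, i.e. $\frac{\log\phi(n)}{n}\to0$ as $n\to\infty$. Let $C_\phi=\{\phi(t)e^{it} : t\in[0,\infty)\}\cup\{(0,0)\}\subset\mathbb{R}^2$ be the associated spiral. Then there exists a bi-Lipschitz homeomorphism $\overline{h}$ of $\mathbb{R}^2$ with the same Lipschitz constant as $h$, such that $\overline{h}(S^1)\subset LD(h(C_\phi))$.
   Context: $\mathbb{R}^2$ is identified with $\mathbb{C}$ and $S^1$ is the unit circle. A map $h:\mathbb{R}^d\to\mathbb{R}^d$ is bi-Lipschitz with (Lipschitz) constant $L>0$ if $\frac1L\|x-y\|\le\|h(x)-h(y)\|\le L\|x-y\|$ for all $x,y\in\mathbb{R}^d$. For $A\subset\mathbb{R}^d$ and a point $o\in\overline{A}$, the set of asymptotic directions of $A$ at $o$ is $$D(A)=\left\{u\in S^{d-1} : \exists\,(a_n)\subset A\setminus\{o\}\text{ with } a_n\to o \text{ and } \frac{a_n-o}{\|a_n-o\|}\to u\right\},$$ and the cone of $A$ at $o$ is $LD(A)=\{tu : u\in D(A),\ t\ge0\}$. The cone $LD(h(C_\phi))$ is taken at the image $o=h(0)$ of the centre $0$ of the spiral. *)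

(* Defs.v *)
From HB Require Import structures.
From mathcomp Require Import all_boot all_order all_algebra.
From mathcomp Require Import all_classical all_reals all_analysis.

Set Implicit Arguments.
Unset Strict Implicit.
Unset Printing Implicit Defensive.

Import Order.TTheory GRing.Theory Num.Theory.
Import numFieldNormedType.Exports.

Local Open Scope classical_set_scope.
Local Open Scope ring_scope.

(* The library norm `|x| on row vectors is the sup norm; the Euclidean norm has
   to be defined. Both induce the same topology, so the library topology on
   'rV[R]_d (used for limits and continuity below) is the usual one. *)
Definition enorm (R : realType) (d : nat) (x : 'rV[R]_d) : R :=
  Num.sqrt (\sum_(i < d) x 0 i ^+ 2).

Definition usphere (R : realType) (d : nat) : set 'rV[R]_d :=
  [set u | enorm u = 1].

Definition bilipschitz (R : realType) (d : nat) (L : R)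
    (h : 'rV[R]_d -> 'rV[R]_d) : Prop :=
  0 < L /\
  forall x y, L^-1 * enorm (x - y) <= enorm (h x - h y) <= L * enorm (x - y).

Definition homeomorphism (T U : topologicalType) (h : T -> U) : Prop :=
  continuous h /\
  exists g : U -> T, [/\ cancel h g, cancel g h & continuous g].

Definition asymptotic_directions (R : realType) (d : nat)
    (A : set 'rV[R]_d) (o : 'rV[R]_d) : set 'rV[R]_d :=
  [set u | usphere u /\
    exists a : nat -> 'rV[R]_d,
      [/\ forall n, (A `\ o) (a n),
          a n @[n --> \oo] --> o &
          (enorm (a n - o))^-1 *: (a n - o) @[n --> \oo] --> u]].

Definition direction_cone (R : realType) (d : nat)
    (A : set 'rV[R]_d) (o : 'rV[R]_d) : set 'rV[R]_d :=
  [set v | exists u t, [/\ asymptotic_directions A o u, 0 <= t & v = t *: u]].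

(* e^{it}, with the complex plane identified with R^2 *)
Definition expi (R : realType) (t : R) : 'rV[R]_2 :=
  \row_(i < 2) if i == 0 then cos t else sin t.

Definition spiral (R : realType) (phi : R -> R) : set 'rV[R]_2 :=
  [set phi t *: expi t | t in `[0, +oo[] `|` [set 0].

(* Main.v *)
(* Since phi decays sub-exponentially, log phi drops by arbitrarily little on
   some windows [n_k, n_k + 8] with n_k -> oo; such a window is longer than
   2 pi, so at scale r_k = phi(n_k) the spiral passes within r_k / k of every
   point of the circle of radius r_k.  The blow-ups
   x |-> (h (r_k x) - h 0) / r_k are bi-Lipschitz with constant L and fix 0.
   Their pointwise limit hbar along a non-principal ultrafilter, which replaces
   Arzela-Ascoli, is bi-Lipschitz with constant L; the limit of the inverses is
   its inverse.  For u on the unit circle, rescaled points of h(spiral)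
   converge to hbar u, so hbar u lies in the cone. *)
Require Import Defs.
From HB Require Import structures.
From mathcomp Require Import all_boot all_order all_algebra.
From mathcomp Require Import all_classical all_reals all_analysis.
From mathcomp Require Import ring lra.

Set Implicit Arguments.
Unset Strict Implicit.
Unset Printing Implicit Defensive.

Import Order.TTheory GRing.Theory Num.Theory.
Import numFieldNormedType.Exports.

Local Open Scope classical_set_scope.
Local Open Scope ring_scope.

(** * Euclidean norm: Cauchy-Schwarz, comparison with the sup norm, limits *)

Section Enorm.
Context (R : realType) (d : nat).
Implicit Types (x y : 'rV[R]_d) (c : R).

Lemma sumsq_ge0 x : 0 <= \sum_(i < d) x 0 i ^+ 2.
Proof. by apply: sumr_ge0 => i _; exact: sqr_ge0. Qed.

Lemma sqr_enorm x : enorm x ^+ 2 = \sum_(i < d) x 0 i ^+ 2.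
Proof. by rewrite sqr_sqrtr// sumsq_ge0. Qed.

Lemma enorm_ge0 x : 0 <= enorm x.
Proof. exact: sqrtr_ge0. Qed.

Lemma coord_le_enorm x i : `|x 0 i| <= enorm x.
Proof.
rewrite -sqrtr_sqr ler_sqrt ?sumsq_ge0// (bigD1 i)//= lerDl.
by apply: sumr_ge0 => j _; exact: sqr_ge0.
Qed.

Lemma norm_le_enorm x : `|x| <= enorm x.
Proof.
rewrite [leLHS]/Num.norm /= mx_normrE; apply/bigmax_leP; split => [|[i j] _ /=].
  exact: enorm_ge0.
by rewrite (ord1 i) coord_le_enorm.
Qed.

Lemma enorm_eq0 x : (enorm x == 0) = (x == 0).
Proof.
apply/idP/idP => [/eqP x0|/eqP->].
  by rewrite -normr_le0 -x0 norm_le_enorm.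
by rewrite /enorm big1 ?sqrtr0// => i _; rewrite mxE expr0n.
Qed.

Lemma enormZ c x : enorm (c *: x) = `|c| * enorm x.
Proof.
rewrite /enorm -sqrtr_sqr -sqrtrM ?sqr_ge0//; congr Num.sqrt.
by rewrite mulr_sumr; apply: eq_bigr => i _; rewrite mxE exprMn.
Qed.

Lemma enormN x : enorm (- x) = enorm x.
Proof. by rewrite -scaleN1r enormZ normrN1 mul1r. Qed.

Lemma dot_le_enorm x y : \sum_(i < d) x 0 i * y 0 i <= enorm x * enorm y.
Proof.
have [->|x0] := eqVneq x 0.
  rewrite big1 ?mulr_ge0 ?enorm_ge0// => i _; by rewrite mxE mul0r.
have [->|y0] := eqVneq y 0.
  rewrite big1 ?mulr_ge0 ?enorm_ge0// => i _; by rewrite mxE mulr0.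
(* Expanding the nonnegative sum of squares below leaves twice this product times the desired
   difference, so it must be positive to be divided out. *)
have ab : 0 < enorm x * enorm y.
  by rewrite mulr_gt0// lt_def enorm_eq0 enorm_ge0 ?x0 ?y0.
have : 0 <= \sum_(i < d) (enorm y * x 0 i - enorm x * y 0 i) ^+ 2.
  by apply: sumr_ge0 => i _; exact: sqr_ge0.
have -> : \sum_(i < d) (enorm y * x 0 i - enorm x * y 0 i) ^+ 2 =
    \sum_(i < d) (enorm y ^+ 2 * x 0 i ^+ 2 +
    (enorm x ^+ 2 * y 0 i ^+ 2 - 2 * (enorm x * enorm y) * (x 0 i * y 0 i))).
  by apply: eq_bigr => i _; ring.
rewrite big_split sumrB /= -!mulr_sumr -!sqr_enorm => h.
rewrite -(ler_pM2l ab); lra.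
Qed.

Lemma ler_enormD x y : enorm (x + y) <= enorm x + enorm y.
Proof.
rewrite -(@ler_pXn2r _ 2)// ?nnegrE ?addr_ge0 ?enorm_ge0// sqr_enorm.
under eq_bigr do rewrite mxE sqrrD -mulr_natl.
rewrite !big_split /= -!sqr_enorm -mulr_sumr sqrrD -[X in _ <= _ + X + _]mulr_natl.
have := dot_le_enorm x y; lra.
Qed.

Lemma enorm_continuous : continuous (@enorm R d).
Proof.
move=> x; apply: continuous_comp; last exact: sqrt_continuous.
apply: continuous_big => [|i _ y]; first exact: add_continuous.
apply: (@continuous_comp _ _ _ (fun x : 'rV[R]_d => x 0 i) (fun c => c ^+ 2)).
  exact: coord_continuous.
exact: exprn_continuous.
Qed.

(** Bridge from Euclidean estimates to the library topology: the sup norm is at most [enorm]. *)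
Lemma cvg_enorm (T : Type) (F : set_system T) (f : T -> 'rV[R]_d) x :
  Filter F -> enorm (f k - x) @[k --> F] --> 0 -> f @ F --> x.
Proof.
move=> FF fx; apply/cvgrPdist_lt => e e0.
move/cvgr0Pnorm_lt : fx => /(_ _ e0); apply: filterS => k.
by rewrite ger0_norm ?enorm_ge0// distrC; apply: le_lt_trans; exact: norm_le_enorm.
Qed.

Lemma enorm_lipschitz_continuous (f : 'rV[R]_d -> 'rV[R]_d) c :
  (forall x y, enorm (f x - f y) <= c * enorm (x - y)) -> continuous f.
Proof.
move=> fc x; apply: (@cvg_enorm _ (nbhs x) f (f x)).
apply: (@squeeze_cvgr _ (nbhs x) _ R (fun=> 0) (fun y => c * enorm (y - x))).
- by apply: nearW => y; rewrite enorm_ge0 fc.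
- exact: cvg_cst.
- have -> : 0 = c * enorm (x - x) :> R.
    by rewrite subrr (eqP (_ : enorm 0 == 0)) ?enorm_eq0// mulr0.
  apply: cvgM; first exact: cvg_cst.
  apply: continuous_comp; last exact: enorm_continuous.
  by apply: (@cvgB _ _ _ (nbhs x) _ id (fun=> x) x x); [exact: cvg_id|exact: cvg_cst].
Qed.

(** The values stay in a compact cube, so the image filter has a cluster point. An ultrafilter
    contains the preimage of each neighbourhood or its complement, and clustering excludes the
    latter. *)
Lemma ultra_enorm_bounded_cvg (T : Type) (F : set_system T) (f : T -> 'rV[R]_d) c :
  UltraFilter F -> (forall k, enorm (f k) <= c) -> exists x, f @ F --> x.
Proof.
move=> FU fc.
have Kco : compact [set v : 'rV[R]_d | forall i, v ord0 i \in `[- c, c]].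
  apply: (@rV_compact _  _ (fun=> `[- c, c]%classic)).
  by move=> _; apply: segment_compact.
have [] := Kco (f @ F) _.
  rewrite nbhs_simpl; apply: (@filterE _ F) => k /= i; rewrite in_itv /= -ler_norml.
  by rewrite (le_trans (coord_le_enorm _ _)).
move=> x [_ fx]; exists x => B Bx.
have [//|FnB] := in_ultra_setVsetC (f @^-1` B) FU.
by have [y []] := fx (~` B) B FnB Bx.
Qed.

End Enorm.

(** * Angles on the circle and windows where the spiral shrinks little *)

(** The integer 8 exceeds the period [2 * pi], so a window of this length contains an angle of every
    direction. *)
Lemma expi_surj (R : realType) (u : 'rV[R]_2) (x : R) : usphere u ->
  exists t, [/\ x <= t, t <= x + 8 & expi t = u].
Proof.
rewrite /usphere /= => u1.
have u01 : u 0 0 ^+ 2 + u 0 (lift ord0 ord0) ^+ 2 = 1.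
  by move: (sqr_enorm u); rewrite u1 expr1n !big_ord_recl big_ord0 addr0.
have [t tu] : exists t, expi t = u.
  have c1 : -1 <= u 0 0 <= 1 by rewrite -ler_norml -u1 coord_le_enorm.
  have su : sin (acos (u 0 0)) = `|u 0 (lift ord0 ord0)|.
    by rewrite sin_acos// -sqrtr_sqr; congr Num.sqrt; lra.
  have [s0|s0] := leP 0 (u 0 (lift ord0 ord0)).
    exists (acos (u 0 0)); apply/rowP => -[[|[|//]] i]; rewrite mxE /=.
      by rewrite acosK//; congr (u _ _); exact: val_inj.
    by rewrite su ger0_norm//; congr (u _ _); exact: val_inj.
  exists (- acos (u 0 0)); apply/rowP => -[[|[|//]] i]; rewrite mxE /=.
    by rewrite cosN acosK//; congr (u _ _); exact: val_inj.
  by rewrite sinN su ltr0_norm// opprK; congr (u _ _); exact: val_inj.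
have pi0 := pi_gt0 R.
have pi8 : pi *+ 2 < 8 :> R by have := @pihalf_lt2 R; rewrite -mulr_natl; lra.
have per (s : R) (n : nat) : expi (s + pi *+ 2 *+ n) = expi s.
  apply/rowP => i; rewrite !mxE.
  by rewrite (periodicn (@cosD2pi R)) (periodicn (@sinD2pi R)).
set p : R := pi *+ 2 in pi8 per.
have p0 : 0 < p by rewrite /p mulrn_wgt0.
(* Moving down [m] periods puts the angle below [x]; the least natural number [n] of periods leading
   strictly past [x] then overshoots by at most one period. *)
pose m := (Num.truncn (`|t - x| / p)).+1.
have tm : t - p *+ m <= x.
  have : `|t - x| / p < m%:R by rewrite truncnS_gt// divr_ge0// ltW.
  rewrite ltr_pdivrMr// mulr_natl => h.
  have := ler_norm (t - x); lra.
set s := t - p *+ m in tm.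
pose n := (Num.truncn ((x - s) / p)).+1.
have sx0 : 0 <= (x - s) / p by rewrite divr_ge0 ?subr_ge0// ltW.
exists (s + p *+ n); split.
- have : (x - s) / p < n%:R by rewrite truncnS_gt.
  rewrite ltr_pdivrMr// mulr_natl; lra.
- have : n.-1%:R <= (x - s) / p by rewrite /n/= truncn_le.
  rewrite ler_pdivlMr// mulr_natl /n /= mulrSr; lra.
- by rewrite per -tu -(per s m) /s subrK.
Qed.

(** Otherwise every [m] steps beyond [N] cost a factor [q], so [u] decays geometrically and
    [ln (u n) / n] stays away from 0 along [n = N + j * m]. *)
Lemma subexp_slow_drop (R : realType) (u : nat -> R) (m N : nat) (q : R) :
  (0 < m)%N -> 0 < q < 1 -> (forall n, 0 < u n <= 1) ->
  ln (u n) / n%:R @[n --> \oo] --> 0 ->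
  exists2 n, (N <= n)%N & q * u n <= u (n + m)%N.
Proof.
move=> m0 /andP[q0 q1] u01 /cvgr0Pnorm_lt u_sub; apply: contrapT => noslow.
have drop n : (N <= n)%N -> u (n + m)%N < q * u n.
  by move=> Nn; rewrite ltNge; apply/negP => qn; apply: noslow; exists n.
have lnq : ln q < 0 by rewrite ln_lt0// q0.
have geom j : u (N + j * m)%N <= q ^+ j.
  elim: j => [|j ih]; first by rewrite addn0 expr0; case/andP: (u01 N).
  rewrite mulSn (addnC m) addnA exprS; apply/ltW.
  by apply: lt_le_trans (drop _ (leq_addr _ _)) _; rewrite ler_pM2l.
have [] := u_sub (- ln q / m.+1%:R); first by rewrite divr_gt0// oppr_gt0.
(* This [j] exceeds both [M], so that [n] is in range, and [N], so that [n <= j * (m + 1)]; the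
   latter explains the tolerance [- ln q / (m + 1)]. *)
move=> M _ HM; pose j := (N + M).+1; pose n := (N + j * m)%N.
have jn : (j <= n)%N by apply: leq_trans (leq_pmulr j m0) _; exact: leq_addl.
have /HM : (M <= n)%N by rewrite (leq_trans _ jn)// leqW// leq_addl.
have un0 : 0 < u n by case/andP: (u01 n).
have n0 : 0 < n%:R :> R by rewrite ltr0n (leq_trans _ jn).
rewrite normrM normfV (ger0_norm (ltW n0)) ltr_pdivrMr// => lnu.
have : ln (u n) <= j%:R * ln q.
  by rewrite mulr_natl -lnXn// ler_ln ?posrE ?exprn_gt0 ?geom.
have : n%:R <= j%:R * m.+1%:R :> R.
  by rewrite -natrM ler_nat /n mulnS leq_add2r leqW// leq_addr.
have m1 : 0 < m.+1%:R :> R by rewrite ltr0n.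
move=> nj; have : - ln q / m.+1%:R * n%:R <= - ln q * j%:R.
  by rewrite -mulrA ler_pM2l ?oppr_gt0// mulrC ler_pdivrMr.
move=> /(lt_le_trans lnu); have := ler_norm (- ln (u n)); rewrite normrN; lra.
Qed.

(** * Limits of bi-Lipschitz maps and of directions along a filter *)

Lemma enorm_cvg (R : realType) (d : nat) (T : Type) (F : set_system T)
    (f : T -> 'rV[R]_d) x :
  Filter F -> f @ F --> x -> enorm (f k) @[k --> F] --> enorm x.
Proof. by move=> FF fx; apply: (cvg_comp _ _ fx); exact: enorm_continuous. Qed.

Lemma bilipschitz_ultralimit (R : realType) (d : nat) (T : Type)
    (F : set_system T) (L : R) (f g : T -> 'rV[R]_d -> 'rV[R]_d) :
  UltraFilter F -> (forall k, bilipschitz L (f k)) ->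
  (forall k, cancel (f k) (g k)) -> (forall k, cancel (g k) (f k)) ->
  (forall k, f k 0 = 0) ->
  exists l : 'rV[R]_d -> 'rV[R]_d,
    [/\ homeomorphism l, bilipschitz L l & forall x, f k x @[k --> F] --> l x].
Proof.
move=> FU fL fK gK f0.
have [k0 _] : [set: T] !=set0 by apply: (@filter_ex _ F); exact: filterT.
have L0 : 0 < L by case: (fL k0).
have e0 : enorm (0 : 'rV[R]_d) = 0 by apply/eqP; rewrite enorm_eq0.
have f_up k x y : enorm (f k x - f k y) <= L * enorm (x - y).
  by case: (fL k) => _ /(_ x y)/andP[].
have f_lo k x y : enorm (x - y) <= L * enorm (f k x - f k y).
  by case: (fL k) => _ /(_ x y)/andP[+ _]; rewrite ler_pdivrMl.
(* Since every [f k] fixes 0, the values at a given point are bounded uniformly in [k]; the same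
   holds for the inverses. *)
have /choice[l lE] (x : 'rV[R]_d) : exists y : 'rV[R]_d, f k x @[k --> F] --> y.
  apply: (@ultra_enorm_bounded_cvg _ _ _ _ _ (L * enorm x)) => k.
  by have := f_up k x 0; rewrite f0 !subr0.
have /choice[m mE] (x : 'rV[R]_d) : exists y : 'rV[R]_d, g k x @[k --> F] --> y.
  apply: (@ultra_enorm_bounded_cvg _ _ _ _ _ (L * enorm x)) => k.
  by have := f_lo k (g k x) 0; rewrite f0 gK !subr0.
have dist_cvg x y :
    enorm (f k x - f k y) @[k --> F] --> enorm (l x - l y).
  by apply: enorm_cvg; apply: cvgB; exact: lE.
have l_up x y : enorm (l x - l y) <= L * enorm (x - y).
  by apply: (cvgr_to_le (dist_cvg x y)); apply: nearW => k; exact: f_up.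
have l_lo x y : enorm (x - y) <= L * enorm (l x - l y).
  rewrite -ler_pdivrMl//; apply: (cvgr_to_ge (dist_cvg x y)).
  by apply: nearW => k; rewrite ler_pdivrMl.
have lm : cancel m l.
  move=> y.
  (* Writing [y = f k (g k y)], the upper Lipschitz bound compares [f k (m y)] with [y] through
     [m y - g k y], which tends to 0. *)
  have fmy : f k (m y) @[k --> F] --> y.
    apply: cvg_enorm.
    apply: (@squeeze_cvgr _ F _ R (fun=> 0) (fun k => L * enorm (m y - g k y))).
    - by apply: nearW => k; rewrite enorm_ge0 -{2}(gK k y) f_up.
    - exact: cvg_cst.
    - have -> : 0 = L * enorm (m y - m y) by rewrite subrr e0 mulr0.
      apply: cvgM; first exact: cvg_cst.
      apply: enorm_cvg; apply: cvgB; [exact: cvg_cst|exact: mE].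
  by apply: (cvg_unique _ (lE (m y)) fmy); exact: norm_hausdorff.
have ml : cancel l m.
  move=> x; apply/eqP; rewrite -subr_eq0 -enorm_eq0 eq_le enorm_ge0 andbT.
  by have := l_lo (m (l x)) x; rewrite lm subrr e0 mulr0.
exists l; split => //.
- split; first exact: enorm_lipschitz_continuous l_up.
  exists m; split=> //; apply: (@enorm_lipschitz_continuous _ _ _ L) => x y.
  by have := l_lo (m x) (m y); rewrite !lm.
- by split=> // x y; rewrite ler_pdivrMl// l_lo l_up.
Qed.

(** The scales [r k] cancel on normalising, so the unit directions tend to [w / enorm w]; here
    [w != 0] makes normalisation continuous at the limit. *)
Lemma direction_cone_cvg (R : realType) (d : nat) (A : set 'rV[R]_d) (o w : 'rV[R]_d)
    (T : Type) (F : set_system T) (a : T -> 'rV[R]_d) (r : T -> R) :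
  ProperFilter F -> (forall k, A (a k)) -> (forall k, 0 < r k) ->
  a @ F --> o -> (r k)^-1 *: (a k - o) @[k --> F] --> w -> w != 0 ->
  direction_cone A o w.
Proof.
move=> FF Aa r0 ao aw w0.
have ew0 : enorm w != 0 by rewrite enorm_eq0.
pose dir k := (enorm (a k - o))^-1 *: (a k - o).
have dirw : dir @ F --> (enorm w)^-1 *: w.
  have dirE k : dir k =
      (enorm ((r k)^-1 *: (a k - o)))^-1 *: ((r k)^-1 *: (a k - o)).
    have rk : r k != 0 by rewrite gt_eqF.
    rewrite enormZ ger0_norm ?invr_ge0 ?ltW// scalerA invfM invrK mulrAC.
    by rewrite mulfV// mul1r.
  under eq_cvg do rewrite dirE.
  by apply: cvgZ => //; apply: cvgV => //; exact: enorm_cvg.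
have ane : \forall k \near F, a k != o.
  have : \forall k \near F, (r k)^-1 *: (a k - o) != 0.
    exact: (@cvgr_neq0 _ _ _ F _ _ w).
  apply: filterS => k; apply: contraNneq => ->.
  by rewrite subrr scaler0.
(* The cone is defined by sequences: each set of the filter is nonempty, so an index good to within
   [1 / (n + 1)] can be picked for each [n]. *)
have /choice[s sP] (n : nat) : exists k, [/\ a k != o,
    `|o - a k| < n.+1%:R^-1 & `|(enorm w)^-1 *: w - dir k| < n.+1%:R^-1].
  have n0 : 0 < n.+1%:R^-1 :> R by rewrite invr_gt0.
  apply: (@filter_ex _ F).
  move/cvgrPdist_lt : ao => /(_ _ n0) Fa.
  move/cvgrPdist_lt : dirw => /(_ _ n0) Fd.
  by apply: filterS3 ane Fa Fd => k.
exists ((enorm w)^-1 *: w), (enorm w); split.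
- split.
    by rewrite /usphere /= enormZ ger0_norm ?invr_ge0 ?enorm_ge0// mulVf.
  exists (a \o s); split.
  + by move=> n; have [/eqP an _ _] := sP n; split; [exact: Aa|exact: an].
  + apply/cvgrPdist_lt => e e0; have := near_infty_natSinv_lt (PosNum e0).
    by apply: filterS => n; have [_ + _] := sP n; exact: lt_trans.
  + apply/cvgrPdist_lt => e e0; have := near_infty_natSinv_lt (PosNum e0).
    by apply: filterS => n; have [_ _ +] := sP n; exact: lt_trans.
- exact: enorm_ge0.
- by rewrite scalerA mulfV// scale1r.
Qed.

Theorem proposition1p1 (R : realType) (L : R) (h : 'rV[R]_2 -> 'rV[R]_2)
    (phi : R -> R)
    (h_homeo : homeomorphism h)
    (h_bilip : bilipschitz L h)
    (phi_range : forall t, 0 <= t -> 0 < phi t <= 1)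
    (phi_cont : {within `[0, +oo[, continuous phi})
    (phi_decr : forall s t, 0 <= s -> s <= t -> phi t <= phi s)
    (phi_lim : phi t @[t --> +oo] --> 0)
    (phi_subexp : ln (phi n%:R) / n%:R @[n --> \oo] --> 0) :
  exists hbar : 'rV[R]_2 -> 'rV[R]_2,
    [/\ homeomorphism hbar,
        bilipschitz L hbar &
        hbar @` usphere (d:=2) `<=` direction_cone (h @` spiral phi) (h 0)].
Proof.
have [L0 hL] := h_bilip.
have h_up x y : enorm (h x - h y) <= L * enorm (x - y).
  by case/andP: (hL x y).
have [_ [g [hK gK _]]] := h_homeo.
have phi0 (n : nat) : 0 < phi n%:R by case/andP: (phi_range n%:R (ler0n _ _)).
(* The ratio [1 - 1 / (k + 2)] tends to 1 and is positive already at [k = 0]. *)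
have /choice[s sP] (k : nat) : exists n, (k <= n)%N /\
    (1 - k.+2%:R^-1) * phi n%:R <= phi (n + 8)%:R.
  have [||n kn slow] := @subexp_slow_drop R (fun n => phi n%:R) 8 k
      (1 - k.+2%:R^-1) isT _ _ phi_subexp; last by exists n.
  - by rewrite subr_gt0 invf_lt1// ltr1n /= gtrBl invr_gt0 ltr0n.
  - by move=> n; exact: phi_range.
pose r k := phi (s k)%:R.
have r0 k : 0 < r k by exact: phi0.
(* [F] refines [\oo], so ordinary limits of sequences remain limits along [F]. *)
have [F [FU oF]] := @ultraFilterLemma nat \oo _.
have rcvg : r @ F --> 0.
  apply: cvg_trans (cvg_app r oF) _.
  have s_oo : s k @[k --> \oo] --> \oo.
    by move=> A [N _ NA]; exists N => // k /= Nk; apply: NA; apply: leq_trans Nk _; case: (sP k).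
  apply: (@cvg_comp _ _ _ s (fun n => phi n%:R) _ _ _ s_oo).
  apply: (@cvg_comp _ _ _ (fun n : nat => n%:R) phi _ _ _ _ phi_lim).
  exact: cvgr_idn.
pose f k x := (r k)^-1 *: (h (r k *: x) - h 0).
pose fi k y := (r k)^-1 *: g (r k *: y + h 0).
have r_neq0 k : r k != 0 by rewrite gt_eqF.
have [||||hbar [hbar_homeo hbarL hbarE]] := @bilipschitz_ultralimit R 2 nat F L f fi FU.
(* Source and target are rescaled by the same factor, which preserves the constant [L]. *)
- move=> k; split=> // x y.
  have -> : f k x - f k y = (r k)^-1 *: (h (r k *: x) - h (r k *: y)).
    by rewrite /f -scalerBr opprB addrA subrK.
  have := hL (r k *: x) (r k *: y).
  rewrite -scalerBr !enormZ normfV (gtr0_norm (r0 k)).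
  by rewrite ler_pdivlMl// [_ <= L * enorm (x - y)]ler_pdivrMl// !(mulrCA (r k)).
- by move=> k x; rewrite /f /fi scalerA mulfV// scale1r subrK hK scalerA mulVf// scale1r.
- by move=> k x; rewrite /f /fi scalerA mulfV// scale1r gK addrK scalerA mulVf// scale1r.
- by move=> k; rewrite /f scaler0 subrr scaler0.
exists hbar; split => // _ [u u1 <-].
have /choice[t tP] (k : nat) : exists t : R,
    [/\ (s k)%:R <= t, t <= (s k)%:R + 8 & expi t = u] by exact: expi_surj.
have t0 k : 0 <= t k by case: (tP k) => st _ _; apply: le_trans st.
(* Monotonicity traps [phi (t k)] between the values of [phi] at the two ends of the slow window. *)
have phit k : (1 - k.+2%:R^-1) * r k <= phi (t k) <= r k.
  have [st ts _] := tP k; rewrite phi_decr// andbT.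
  by apply: le_trans (sP k).2 _; rewrite natrD phi_decr.
have phit_r k : enorm (phi (t k) *: u - r k *: u) <= k.+2%:R^-1 * r k.
  rewrite -scalerBl enormZ u1 mulr1 ler_norml; have /andP[+ +] := phit k.
  rewrite mulrBl mul1r; have : 0 <= k.+2%:R^-1 * r k by rewrite mulr_ge0// ?invr_ge0// ltW.
  move: (k.+2%:R^-1 * r k) => c ? ? ?; apply/andP; split; lra.
pose a k := h (phi (t k) *: u).
apply: (@direction_cone_cvg _ _ _ _ _ _ F a r) => //.
- move=> k; exists (phi (t k) *: u) => //; left; exists (t k).
    by rewrite /= in_itv /= t0.
  by have [_ _ ->] := tP k.
- apply: cvg_enorm; apply: (@squeeze_cvgr _ F _ R (fun=> 0) (fun k => L * r k)).
  + apply: nearW => k; rewrite enorm_ge0 /=.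
    apply: le_trans (h_up _ _) _; rewrite ler_pM2l// subr0 enormZ u1 mulr1.
    have := phit k; have /andP[p0 _] := phi_range _ (t0 k); rewrite gtr0_norm//.
    by case/andP.
  + exact: cvg_cst.
  + rewrite -[X in _ --> X](mulr0 L); apply: cvgM => //; exact: cvg_cst.
(* Replacing the spiral point by [r k *: u] turns the quotient into [f k u]; after division by [r k]
   the error is at most [L / (k + 2)]. *)
- have -> : hbar u = 0 + hbar u by rewrite add0r.
  have -> : (fun k => (r k)^-1 *: (a k - h 0)) =
      (fun k => ((r k)^-1 *: (a k - h 0) - f k u) + f k u).
    by apply/funext => k; rewrite subrK.
  apply: cvgD; last exact: hbarE.
  apply: cvg_enorm.
  apply: (@squeeze_cvgr _ F _ R (fun=> 0) (fun k => L * k.+2%:R^-1)).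
  + apply: nearW => k; rewrite enorm_ge0 /= subr0 /f -scalerBr opprB addrA subrK.
    rewrite enormZ normfV (gtr0_norm (r0 k)) ler_pdivrMl//.
    apply: le_trans (h_up _ _) _; rewrite mulrCA ler_pM2l// mulrC.
    exact: phit_r.
  + exact: cvg_cst.
  + rewrite -[X in _ --> X](mulr0 L); apply: cvgM; first exact: cvg_cst.
    apply: cvg_trans (cvg_app _ oF) _.
    by have := @cvg_harmonic R; rewrite -(cvg_shiftS (@harmonic R : nat -> R^o)).
(* As [hbar] fixes 0, its lower Lipschitz bound gives [enorm (hbar u) >= L^-1 > 0]. *)
- rewrite -enorm_eq0 gt_eqF//.
  have [_ /(_ u 0)/andP[+ _]] := hbarL.
  have -> : hbar 0 = 0.
    have := hbarE 0; rewrite /f; under eq_cvg do rewrite scaler0 subrr scaler0.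
    by move=> h0; apply/esym; apply: (cvg_unique _ _ h0); [exact: norm_hausdorff|exact: cvg_cst].
  rewrite !subr0 u1 mulr1; apply: lt_le_trans; by rewrite invr_gt0.
Qed.
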